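(* Let $(\mathfrak g,J,g)$ be a $2n$-dimensional almost abelian pseudo-Kähler Lie algebra with $\mathfrak h_0$ isotropic, so that $\mathfrak g=\mathfrak h\rtimes_D\mathrm{Span}\{e_{2n}\}$, with a basis $\{e_1,\dots,e_{2n}\}$ of $\mathfrak g$ such that $\mathfrak h=\mathrm{Span}\{e_1,\dots,e_{2n-1}\}$, $V=\mathrm{Span}\{e_3,\dots,e_{2n-2}\}$, $Je_{2i-1}=e_{2i}$, $g=e^1\odot e^{2n}-e^2\odot e^{2n-1}+\sum_{i=3}^{2n-2}\varepsilon_i e^i\otimes e^i$ with $\varepsilon_i=\pm1$, and, with respect to $\mathfrak h=\mathrm{Span}\{e_1\}\oplus\mathrm{Span}\{e_2\}\oplus V\oplus\mathrm{Span}\{e_{2n-1}\}$, $$D=\begin{pmatrix}-a&0&-(J_Vv)^{\flat_V}&c_1\\0&-a&v^{\flat_V}&c_2\\0&0&A&v\\0&0&0&a\end{pmatrix},\qquad A\in\mathfrak u(V,J_V,g_V),\ v\in V,\ a,c_1,c_2\in\mathbb R.$$ Then the Levi-Civita connection is given by: (1) $\nabla_{e_1}=\nabla_{e_2}=0$; (2) $\nabla_X=0$ for $X\in V$; (3) $\nabla_{e_{2n-1}}=-c_2(e^{2n-1}\otimes e_1+e^{2n}\otimes e_2)$; (4) $\nabla_{e_{2n}}X=g(v,JX)e_1+g(v,X)e_2+AX$ for $X\in V$, and $\nabla_{e_{2n}}e_1=-ae_1$, $\nabla_{e_{2n}}e_2=-ae_2$, $\nabla_{e_{2n}}e_{2n-1}=c_1e_1+v+ae_{2n-1}$,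 $\nabla_{e_{2n}}e_{2n}=c_1e_2+Jv+ae_{2n}$. Moreover, the only nonzero curvature term is $$R(e_{2n-1},e_{2n})=-3ac_2(e^{2n-1}\otimes e_1+e^{2n}\otimes e_2)=3a\nabla_{e_{2n-1}},$$ and the metric $g$ is Ricci-flat.
   Context: Lie algebras are real. $\mathfrak g$ is almost abelian if it has a codimension-one abelian ideal $\mathfrak h$; $\mathfrak g=\mathfrak h\rtimes_D\mathrm{Span}\{e_{2n}\}$ with $D=\mathrm{ad}(e_{2n})|_{\mathfrak h}$. A pseudo-Kähler structure on $\mathfrak g$ is a pair $(J,g)$ with $J\in\mathrm{End}(\mathfrak g)$, $J^2=-\mathrm{Id}$, $[X,Y]+J[JX,Y]+J[X,JY]-[JX,JY]=0$; $g$ a nondegenerate symmetric bilinear form of arbitrary signature with $g(JX,JY)=g(X,Y)$; and $\omega=g(J\cdot,\cdot)$ closed, i.e. $\omega([X,Y],Z)+\omega([Y,Z],X)+\omega([Z,X],Y)=0$. $\mathfrak h_0=\mathfrak h^\perp\oplus J\mathfrak h^\perp$ is isotropic if $g|_{\mathfrak h_0}=0$; in that case a basis and a form of $D$ as in the claim always exist. Notation: $\{e^i\}$ is the dual basis; $e^i\odot e^j=e^i\otimes e^j+e^j\otimes e^i$; $e^i\otimes e_j$ is the endomorphism $X\mapsto e^i(X)e_j$; $J_V,g_V$ are the restrictions of $J,g$ to $V$; $v^{\flat_V}=g_V(v,\cdot)$; $\mathfrak u(V,J_V,g_V)$ is the Lie algebra of endomorphisms of $V$ commuting with $J_V$ and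 skew-symmetric with respect to $g_V$. The Levi-Civita connection is $2g(\nabla_XY,Z)=g([X,Y],Z)-g([Y,Z],X)+g([Z,X],Y)$; $R(X,Y)=[\nabla_X,\nabla_Y]-\nabla_{[X,Y]}$; $\mathrm{Ric}(v,w)=\mathrm{tr}(X\mapsto R(X,v)w)$. ''The only nonzero curvature term'' means that $R(e_i,e_j)=0$ for all $i<j$ except $(i,j)=(2n-1,2n)$ (where the given expression may also vanish). *)

(* Defs.v *)
From HB Require Import structures.
From mathcomp Require Import all_boot all_order all_algebra.
From mathcomp Require Import reals ring.

Set Implicit Arguments.
Unset Strict Implicit.
Unset Printing Implicit Defensive.

Import Order.TTheory GRing.Theory Num.Theory.
Local Open Scope ring_scope.

Section LieAlgebra.
Variables (R : realType) (L : vectType R).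
Implicit Types (br : {bilinear L -> L -> L}) (J : 'End(L)) (g : {symmetric L}).
Implicit Types (h : {vspace L}) (nabla : {linear L -> 'End(L)}).

Record lie_bracket br : Prop := LieBracket {
  lie_alternating : forall x, br x x = 0;
  lie_jacobi : forall x y z,
    br x (br y z) + br y (br z x) + br z (br x y) = 0 }.

Definition ad br (x : L) : 'End(L) := linfun (br x).

Record codim1_abelian_ideal br h : Prop := Codim1AbelianIdeal {
  codim1_dim : (\dim h).+1 = \dim {:L};
  codim1_ideal : forall x y, y \in h -> br x y \in h;
  codim1_abelian : {in h &, forall x y, br x y = 0} }.

Record complex_structure br J : Prop := ComplexStructure {
  complex_sqr : forall x, J (J x) = - x;
  complex_integrable : forall x y,
    br x y + J (br (J x) y) + J (br x (J y)) - br (J x) (J y) = 0 }.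

Definition fundamental_form J g (x y : L) : R := g (J x) y.

Record pseudo_kahler br J g : Prop := PseudoKahler {
  pk_complex : complex_structure br J;
  pk_nondegenerate : nondegenerate g;
  pk_hermitian : forall x y, g (J x) (J y) = g x y;
  pk_closed : forall x y z,
    fundamental_form J g (br x y) z + fundamental_form J g (br y z) x
    + fundamental_form J g (br z x) y = 0 }.

Definition h0_space J g h : {vspace L} := (orthov g h + J @: orthov g h)%VS.

Definition isotropic g (U : {vspace L}) : Prop :=
  {in U &, forall x y, g x y = 0}.

(* nabla x is the endomorphism y |-> nabla_x y; for g nondegenerate the formula
   determines nabla, see levi_civita_exists and levi_civita_unique below *)
Definition levi_civita br g nabla : Prop := forall x y z,
  2 * g (nabla x y) z = g (br x y) z - g (br y z) x + g (br z x) y.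

Definition curvature br nabla (x y : L) : 'End(L) :=
  (nabla x \o nabla y)%VF - (nabla y \o nabla x)%VF - nabla (br x y).

Definition endo_trace (f : 'End(L)) : R :=
  \tr (passmx.mxof (vbasis {:L}) (vbasis {:L}) f).

Definition ricci br nabla (v w : L) : R :=
  endo_trace (linfun (fun x => curvature br nabla x v w)).

End LieAlgebra.

Section Restriction.
Variables (R : realType) (L : vectType R) (V : {vspace L}).

(* meaningful when J preserves V *)
Definition restr_endo (J : 'End(L)) : 'End(subvs_of V) :=
  linfun (fun x => vsproj V (J (vsval x))).

Definition restr_form (g : {symmetric L}) (x y : subvs_of V) : R :=
  g (vsval x) (vsval y).

End Restriction.

Definition unitary_algebra (R : realType) (W : vectType R) (J : 'End(W))
    (g : W -> W -> R) (A : 'End(W)) : Prop :=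
  (forall x, A (J x) = J (A x)) /\ (forall x y, g (A x) y = - g x (A y)).

(* Bases are functions e : nat -> L of which only e 1, ..., e (2 * n) matter. *)
Section AdaptedBasis.
Variables (R : realType) (L : vectType R) (n : nat) (e : nat -> L).

Definition basis_tuple : (2 * n).-tuple L := [tuple e i.+1 | i < 2 * n].

(* the dual basis e^i, for 1 <= i <= 2 * n *)
Definition dual_basis (i : nat) (x : L) : R :=
  \sum_(k < 2 * n | k.+1 == i) coord basis_tuple k x.

Definition tensor_endo (i j : nat) : 'End(L) :=
  linfun (fun x => dual_basis i x *: e j).

Definition odot (p q : L -> R) (x y : L) : R := p x * q y + q x * p y.

(* Span {e_i, ..., e_j} *)
Definition span_range (i j : nat) : {vspace L} :=
  <<[seq e k | k <- index_iota i j.+1]>>%VS.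

Record adapted_basis (J : 'End(L)) (g : {symmetric L}) (h V : {vspace L})
    (eps : nat -> R) : Prop := AdaptedBasis {
  adapted_is_basis : basis_of fullv basis_tuple;
  adapted_h : h = span_range 1 (2 * n - 1);
  adapted_V : V = span_range 3 (2 * n - 2);
  adapted_J : forall i, (1 <= i <= n)%N -> J (e (2 * i - 1)%N) = e (2 * i)%N;
  adapted_eps : forall i, (3 <= i <= 2 * n - 2)%N -> eps i = 1 \/ eps i = -1;
  adapted_g : forall x y, g x y =
    odot (dual_basis 1) (dual_basis (2 * n)) x y
    - odot (dual_basis 2) (dual_basis (2 * n - 1)) x y
    + \sum_(3 <= i < (2 * n - 2).+1) eps i * (dual_basis i x * dual_basis i y) }.

(* The columns of the block matrix of D with respect to the decomposition
   h = Span {e_1} + Span {e_2} + V + Span {e_(2n-1)}; D is only constrained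
   on h. *)
Record block_form (J : 'End(L)) (g : {symmetric L}) (V : {vspace L})
    (D : 'End(L)) (a c1 c2 : R) (v : subvs_of V) (A : 'End(subvs_of V)) : Prop :=
  BlockForm {
  block_e1 : D (e 1%N) = - a *: e 1%N;
  block_e2 : D (e 2%N) = - a *: e 2%N;
  block_V : forall x : subvs_of V, D (vsval x) =
    - restr_form g (restr_endo V J v) x *: e 1%N
    + restr_form g v x *: e 2%N + vsval (A x);
  block_last : D (e (2 * n - 1)%N) =
    c1 *: e 1%N + c2 *: e 2%N + vsval v + a *: e (2 * n - 1)%N }.

End AdaptedBasis.

Section BasicFacts.
Variables (R : realType) (L : vectType R).

Lemma dual_basisE n (e : nat -> L) i j : basis_of fullv (basis_tuple n e) ->
  (1 <= i <= 2 * n)%N -> (1 <= j <= 2 * n)%N ->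
  dual_basis n e i (e j) = (i == j)%:R.
Proof.
move=> eb; case: i => [//|i]; case: j => [|j] ilt jlt //.
rewrite /dual_basis.
rewrite (bigD1 (Ordinal ilt)) //= big1 ?addr0; last first.
  by move=> k /andP[/eqP[ki] /eqP]; case; apply: val_inj.
have -> : e j.+1 = (basis_tuple n e)`_(Ordinal jlt).
  by rewrite -tnth_nth tnth_mktuple.
by rewrite coord_free ?(basis_free eb) // eq_sym.
Qed.

Lemma ricciE (br : {bilinear L -> L -> L}) (nabla : {linear L -> 'End(L)})
    (v w x : L) :
  linfun (fun x => curvature br nabla x v w) x = curvature br nabla x v w.
Proof.
pose f x := curvature br nabla x v w.
have lin_f : linear f.
  move=> a y z; rewrite /f /curvature !(add_lfunE, opp_lfunE, comp_lfunE).
  rewrite linearPl !linearP /= !(add_lfunE, scale_lfunE) linearP /= !scalerBr.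
  by rewrite !opprD [X in X + _ = _]addrACA [LHS]addrACA.
pose fL := GRing.isLinear.Build _ _ _ _ f lin_f.
pose F : {linear L -> L} := HB.pack f fL.
exact: (lfunE F x).
Qed.

Lemma levi_civita_unique (br : {bilinear L -> L -> L}) (g : {symmetric L})
    (n1 n2 : {linear L -> 'End(L)}) :
  nondegenerate g -> levi_civita br g n1 -> levi_civita br g n2 -> n1 =1 n2.
Proof.
move=> /eqP g0 h1 h2 x; apply/lfunP => y; apply/eqP; rewrite -subr_eq0.
rewrite -memv0 -g0; apply/mem_orthovP => z _; rewrite linearBl.
have two0 : (2 : R) != 0 by rewrite pnatr_eq0.
by apply: (mulfI two0); rewrite mulrBr h1 h2 subrr mulr0.
Qed.

Lemma levi_civita_exists (br : {bilinear L -> L -> L}) (g : {symmetric L}) :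
  nondegenerate g -> exists nabla : {linear L -> 'End(L)}, levi_civita br g nabla.
Proof.
move=> /eqP g0.
pose fl x : 'Hom(L, R^o) := linfun (g x : L -> R^o).
have flE x z : fl x z = g x z by rewrite /fl (lfunE (g x : {linear L -> R^o})).
have fl_lin : linear fl.
  by move=> c x y; apply/lfunP => z;
     rewrite add_lfunE scale_lfunE !flE linearPl.
pose FL : {linear L -> 'Hom(L, R^o)} :=
  HB.pack fl (GRing.isLinear.Build _ _ _ _ fl fl_lin).
pose flat : 'Hom(L, 'Hom(L, R^o)) := linfun FL.
have flatE x z : flat x z = g x z by rewrite /flat lfunE flE.
have ker0 : lker flat = 0%VS.
  apply/eqP; rewrite -subv0; apply/subvP => x; rewrite memv_ker -g0 => /eqP fx.
  by apply/mem_orthovP => z _; rewrite -flatE fx zero_lfunE.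
have img : limg flat = fullv.
  apply/eqP; rewrite eqEdim subvf /=.
  rewrite (limg_dim_eq (f := flat)) ?ker0 ?capv0 // !dimvf /dim /= muln1.
  exact: leqnn.
have sharpK phi z : g ((flat^-1)%VF phi) z = phi z.
  by rewrite -flatE limg_lfunVK // img memvf.
pose K x y z : R^o := 2^-1 * (g (br x y) z - g (br y z) x + g (br z x) y).
have K_lin x y : linear (K x y).
  move=> c u w; rewrite /K !(linearPl, linearPr) /= /GRing.scale /=; ring.
have KE x y z : linfun (K x y) z = K x y z.
  pose KL : {linear L -> R^o} :=
    HB.pack (K x y) (GRing.isLinear.Build _ _ _ _ (K x y) (K_lin x y)).
  exact: (lfunE KL z).
pose N x y := (flat^-1)%VF (linfun (K x y)).
have N_lin x : linear (N x).
  move=> c u w; rewrite /N -linearP; congr (_ _); apply/lfunP => z.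
  rewrite add_lfunE scale_lfunE !KE /K !(linearPl, linearPr) /= /GRing.scale /=.
  ring.
have NE x y : linfun (N x) y = N x y.
  pose NL : {linear L -> L} :=
    HB.pack (N x) (GRing.isLinear.Build _ _ _ _ (N x) (N_lin x)).
  exact: (lfunE NL y).
pose nabla x : 'End(L) := linfun (N x).
have nabla_lin : linear nabla.
  move=> c u w; apply/lfunP => y.
  rewrite add_lfunE scale_lfunE !NE /N -linearP; congr (_ _); apply/lfunP => z.
  rewrite add_lfunE scale_lfunE !KE /K !(linearPl, linearPr) /= /GRing.scale /=.
  ring.
pose nablaL : {linear L -> 'End(L)} :=
  HB.pack nabla (GRing.isLinear.Build _ _ _ _ nabla nabla_lin).
exists nablaL => x y z /=.
rewrite NE sharpK KE /K mulrA divff ?mul1r //.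
by rewrite pnatr_eq0.
Qed.

End BasicFacts.

(* Main.v *)
Require Import Defs.
From HB Require Import structures.
From mathcomp Require Import all_boot all_order all_algebra.
From mathcomp Require Import reals ring zify.
Import Order.TTheory GRing.Theory Num.Theory.
Local Open Scope ring_scope.

(** Write a vector of L as x = x1 e_1 + x2 e_2 + w + xp e_p + xq e_q with w in V,
    p = 2 n - 1 and q = 2 n.  In these coordinates the metric pairs (x1, xq)
    and (x2, xp) hyperbolically and is orthogonal to V otherwise, and the
    bracket is xq D y - yq D x for the block matrix D.  The Koszul formula then
    becomes a polynomial identity in the coordinates, once the skew-symmetry
    of A and of J on V is used; lemma nabla_frame solves it.

    Only two of its consequences matter for the curvature.  First, nabla_x
    depends on xp and xq alone: nabla_x = xp N + xq M with N = nabla_(e_p) and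
    M = nabla_(e_q).  Second, N reads only the p and q coordinates, which M
    multiplies by a, and takes its values in Span {e_1, e_2}, on which M is
    - a.  Hence N M = a N, M N = - a N, so [N, M] = 2 a N.  Since the p
    coordinate of [x, y] is - a (xp yq - xq yp) and its q coordinate is 0,

      R(x, y) = (xp yq - xq yp) ([N, M] + a N) = 3 a (xp yq - xq yp) N,

    which gives the curvature (curvatureE).  For fixed y and z the map
    x |-> R(x, y) z therefore has rank at most one: it is phi(x) u, where phi
    reads the p and q coordinates and u lies in Span {e_1, e_2}.  Its trace
    phi(u) vanishes, so the metric is Ricci-flat (ricci_flat). *)

Set Implicit Arguments.
Unset Strict Implicit.

(** * Rank-one endomorphisms and dual bases *)

Lemma endo_trace_rank_one (R : realType) (L : vectType R) (phi : {scalar L})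
    (u : L) (f : 'End(L)) :
  (forall x, f x = phi x *: u) -> endo_trace f = phi u.
Proof.
move=> fE; rewrite /endo_trace /mxtrace [in RHS](coord_vbasis (memvf u)).
rewrite linear_sum; apply: eq_bigr => i _ /=.
rewrite /passmx.mxof mxE /= /passmx.vecof.
rewrite (bigD1 i) //= big1 ?addr0 => [|j ji]; last first.
  by rewrite !mxE (negPf ji) andbF scale0r.
by rewrite !mxE !eqxx scale1r fE !linearZ /= mulrC.
Qed.

Section DualBasis.
Variables (R : realType) (L : vectType R) (n : nat) (e : nat -> L).

Fact dual_basis_is_scalar i : scalar (dual_basis n e i).
Proof.
move=> c x y; rewrite /dual_basis mulr_sumr -big_split /=.
by apply: eq_bigr => k _; rewrite linearP.
Qed.

HB.instance Definition _ i :=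
  GRing.isLinear.Build R L R *%R (dual_basis n e i) (dual_basis_is_scalar i).

Lemma tensor_endoE i j x : tensor_endo n e i j x = dual_basis n e i x *: e j.
Proof.
pose f x := dual_basis n e i x *: e j.
have lin_f : linear f by move=> c y z; rewrite /f linearP scalerDl scalerA.
pose F : {linear L -> L} := HB.pack f (GRing.isLinear.Build _ _ _ _ f lin_f).
exact: (lfunE F x).
Qed.

Hypothesis e_basis : basis_of fullv (basis_tuple n e).

Lemma dual_basis_expansion x :
  x = \sum_(1 <= i < (2 * n).+1) dual_basis n e i x *: e i.
Proof.
rewrite {1}(coord_basis e_basis (memvf x)) big_add1 big_mkord.
apply: eq_bigr => i _; rewrite -tnth_nth tnth_mktuple; congr (_ *: _).
by rewrite /dual_basis (big_pred1 i) // => k; rewrite eqSS -val_eqE.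
Qed.

Lemma dual_basis_span_range i j k x : (1 <= i)%N -> (j <= 2 * n)%N ->
  (1 <= k <= 2 * n)%N -> ~~ (i <= k <= j)%N ->
  x \in span_range e i j -> dual_basis n e k x = 0.
Proof.
move=> i1 jn kn kij /coord_span ->; rewrite linear_sum big1 //= => l _.
have /mapP[m mij ->] : [seq e s | s <- index_iota i j.+1]`_l
    \in [seq e s | s <- index_iota i j.+1].
  by rewrite mem_nth // size_map size_iota.
move: mij; rewrite mem_index_iota => mij.
have mn : (1 <= m <= 2 * n)%N by lia.
rewrite linearZ /= dual_basisE //; case: eqP => [km|_]; last by rewrite mulr0.
by move: kij; rewrite km -ltnS mij.
Qed.
End DualBasis.

(** For n = 1 the pairs (e^1, e^(2n)) and (e^2, e^(2n-1)) use the same two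
    covectors and the two terms of the metric cancel, so that it is degenerate;
    for n = 0 there is no hyperplane.  From n = 2 on, the indices 1, 2, 2n - 1
    and 2n are distinct. *)
Lemma adapted_basis_ge2 (R : realType) (n : nat) (L : vectType R)
    (br : {bilinear L -> L -> L}) (J : 'End(L)) (g : {symmetric L})
    (h V : {vspace L}) (e : nat -> L) (eps : nat -> R) :
  \dim {:L} = (2 * n)%N -> codim1_abelian_ideal br h -> nondegenerate g ->
  adapted_basis n e J g h V eps -> (2 <= n)%N.
Proof.
move=> dimL [dimh _ _] /eqP g0 adapted.
case: n => [|[|//]] in dimL adapted *; first by rewrite dimL in dimh.
have gE x y : g x y = 0.
  rewrite (adapted_g adapted) big_geq //= /odot; ring.
suff L0 : {:L}%VS = 0%VS by rewrite L0 dimv0 in dimL.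
apply/eqP; rewrite -subv0 -g0; apply/subvP => x _.
by apply/mem_orthovP.
Qed.

(** * Coordinates on an almost abelian Lie algebra *)

Section AlmostAbelian.
Variables (R : realType) (n : nat) (L : vectType R).
Variables (br : {bilinear L -> L -> L}) (J : 'End(L)) (g : {symmetric L}).
Variables (h V : {vspace L}) (e : nat -> L) (eps : nat -> R).
Variables (a c1 c2 : R) (v : subvs_of V) (A : 'End(subvs_of V)).
Variable nabla : {linear L -> 'End(L)}.
Hypothesis n_ge2 : (2 <= n)%N.
Hypothesis lie_br : lie_bracket br.
Hypothesis codim1_h : codim1_abelian_ideal br h.
Hypothesis pk : pseudo_kahler br J g.
Hypothesis adapted : adapted_basis n e J g h V eps.
Hypothesis unitary_A : unitary_algebra (restr_endo V J) (restr_form g) A.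
Hypothesis block_D : block_form n e J g (ad br (e (2 * n)%N)) a c1 c2 v A.
Hypothesis lc : levi_civita br g nabla.

Local Notation d := (dual_basis n e).
Local Notation p := (2 * n - 1)%N.
Local Notation q := (2 * n)%N.

Let e_basis : basis_of fullv (basis_tuple n e) := adapted_is_basis adapted.

(** The V component is an element of the subspace type, on which A and the
    restriction of J act directly. *)
Definition frame (x1 x2 : R) (w : subvs_of V) (xp xq : R) : L :=
  x1 *: e 1%N + x2 *: e 2%N + vsval w + xp *: e p + xq *: e q.

Lemma frame_linear c x1 x2 w xp xq y1 y2 u yp yq :
  c *: frame x1 x2 w xp xq + frame y1 y2 u yp yq =
  frame (c * x1 + y1) (c * x2 + y2) (c *: w + u) (c * xp + yp) (c * xq + yq).
Proof.
rewrite /frame !scalerDr !scalerA !scalerDl linearP /=.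
by rewrite addrACA; congr (_ + _); rewrite addrACA; congr (_ + _);
  rewrite addrACA; congr (_ + _); rewrite addrACA.
Qed.

Lemma frameD x1 x2 w xp xq y1 y2 u yp yq :
  frame x1 x2 w xp xq + frame y1 y2 u yp yq =
  frame (x1 + y1) (x2 + y2) (w + u) (xp + yp) (xq + yq).
Proof.
by rewrite -[X in X + _]scale1r frame_linear !mul1r scale1r.
Qed.

Lemma frameZ c x1 x2 w xp xq :
  c *: frame x1 x2 w xp xq =
  frame (c * x1) (c * x2) (c *: w) (c * xp) (c * xq).
Proof.
have f0 : frame 0 0 0 0 0 = 0 by rewrite /frame !scale0r raddf0 !addr0.
by rewrite -[LHS]addr0 -f0 frame_linear !addr0.
Qed.

Lemma e1_frame : e 1%N = frame 1 0 0 0 0.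
Proof. by rewrite /frame scale1r !scale0r raddf0 !addr0. Qed.

Lemma e2_frame : e 2%N = frame 0 1 0 0 0.
Proof. by rewrite /frame scale1r !scale0r raddf0 !addr0 add0r. Qed.

Lemma V_frame w : vsval w = frame 0 0 w 0 0.
Proof. by rewrite /frame !scale0r !addr0 !add0r. Qed.

Lemma ep_frame : e p = frame 0 0 0 1 0.
Proof. by rewrite /frame scale1r !scale0r raddf0 !addr0 !add0r. Qed.

Lemma eq_frame : e q = frame 0 0 0 0 1.
Proof. by rewrite /frame scale1r !scale0r raddf0 !addr0 !add0r. Qed.

Lemma dual_basis_V k (w : subvs_of V) :
  (1 <= k <= 2)%N || (p <= k <= q)%N -> d k (vsval w) = 0.
Proof.
move=> kb; apply: (dual_basis_span_range (i := 3) (j := 2 * n - 2) e_basis).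
all: try by lia.
by rewrite -(adapted_V adapted) subvsP.
Qed.

Lemma dual_basis_frame x1 x2 w xp xq (x := frame x1 x2 w xp xq) :
  [/\ d 1 x = x1, d 2 x = x2, d p x = xp & d q x = xq].
Proof.
have p_neq1 : (p == 1)%N = false by lia.
have p_neq2 : (p == 2)%N = false by lia.
have q_neq1 : (q == 1)%N = false by lia.
have q_neq2 : (q == 2)%N = false by lia.
have q_neqp : (q == p)%N = false by lia.
split; rewrite /x /frame !linearD /= !linearZ /= dual_basis_V ?dual_basisE //;
  try lia.
all: rewrite ?eqxx ?p_neq1 ?p_neq2 ?q_neq1 ?q_neq2 ?q_neqp.
all: rewrite ?(eq_sym _ p) ?(eq_sym _ q) ?eqxx.
all: rewrite ?p_neq1 ?p_neq2 ?q_neq1 ?q_neq2 ?q_neqp /=.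
all: ring.
Qed.

Lemma frameP x : exists w, x = frame (d 1 x) (d 2 x) w (d p x) (d q x).
Proof.
pose w := \sum_(3 <= i < p) d i x *: e i.
have wV : w \in V.
  rewrite (adapted_V adapted) /w big_seq rpred_sum // => i.
  rewrite mem_index_iota => i3p; rewrite rpredZ // memv_span // map_f //.
  rewrite mem_index_iota; lia.
exists (vsproj V w); rewrite /frame vsprojK //.
rewrite [LHS](dual_basis_expansion e_basis).
have q_eq : q = p.+1 by lia.
rewrite {1}q_eq !big_nat_recr /=; try lia.
rewrite -q_eq big_ltn 1?big_ltn ?addrA //; lia.
Qed.

(** * Metric, complex structure and bracket in coordinates *)

Lemma g_frame x1 x2 w xp xq y1 y2 u yp yq :
  g (frame x1 x2 w xp xq) (frame y1 y2 u yp yq) =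
  x1 * yq + xq * y1 - x2 * yp - xp * y2 + g (vsval w) (vsval u).
Proof.
have gVE (s t : subvs_of V) : g (vsval s) (vsval t) =
    \sum_(3 <= i < (2 * n - 2).+1) eps i * (d i (vsval s) * d i (vsval t)).
  rewrite (adapted_g adapted) /odot.
  rewrite !(@dual_basis_V 1, @dual_basis_V 2, @dual_basis_V p, @dual_basis_V q);
    try lia.
  ring.
have dV i y1' y2' s yp' yq' : (3 <= i < p)%N ->
    d i (frame y1' y2' s yp' yq') = d i (vsval s).
  move=> ip; rewrite /frame !linearD /= !linearZ /= !dual_basisE //; try lia.
  have -> : (i == 1)%N = false by lia.
  have -> : (i == 2)%N = false by lia.
  have -> : (i == p)%N = false by lia.
  have -> : (i == q)%N = false by lia.
  rewrite /=; ring.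
rewrite (adapted_g adapted) /odot gVE.
have [-> -> -> ->] := dual_basis_frame x1 x2 w xp xq.
have [-> -> -> ->] := dual_basis_frame y1 y2 u yp yq.
congr (_ + _); first ring.
rewrite !big_nat; apply: eq_bigr => i i3p.
rewrite !dV //; lia.
Qed.

Lemma J_odd i : (1 <= i <= n)%N -> J (e (2 * i - 1)%N) = e (2 * i)%N.
Proof. exact: (adapted_J adapted). Qed.

Let JJ x : J (J x) = - x := complex_sqr (pk_complex pk) x.

Lemma J_even i : (1 <= i <= n)%N -> J (e (2 * i)%N) = - e (2 * i - 1)%N.
Proof. by move=> i1n; rewrite -J_odd // JJ. Qed.

(** J preserves V because 3, ..., 2n - 2 is made of whole pairs 2k - 1, 2k; hence
    the restriction of J is computed by J itself. *)
Lemma J_V (w : subvs_of V) : vsval (restr_endo V J w) = J (vsval w).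
Proof.
have JV : J (vsval w) \in V.
  rewrite memv_preim; move: (subvsP w); apply: subvP.
  rewrite {1}(adapted_V adapted); apply/span_subvP => x /mapP[i].
  rewrite mem_index_iota => i3p ->; rewrite -memv_preim (adapted_V adapted).
  have [k [k1n ki]] : exists k, (1 <= k <= n)%N /\ (i = 2 * k - 1 \/ i = 2 * k)%N.
    by exists (uphalf i); lia.
  case: ki i3p => -> i3p; rewrite ?J_odd ?J_even // ?rpredN memv_span //;
    rewrite map_f // mem_index_iota; lia.
by rewrite /restr_endo (lfunE (vsproj V \o (J \o vsval))) /= vsprojK.
Qed.

Lemma g_J_V (w u : subvs_of V) :
  g (J (vsval w)) (vsval u) = - g (vsval w) (J (vsval u)).
Proof. by rewrite -(pk_hermitian pk) JJ linearNl. Qed.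

Lemma g_A_V (w u : subvs_of V) :
  g (vsval (A w)) (vsval u) = - g (vsval (A u)) (vsval w).
Proof.
have [_ gA] := unitary_A.
by rewrite [LHS](gA w u) /restr_form hermC /= expr0 mul1r.
Qed.

Lemma br_q_frame y1 y2 u yp yq :
  br (e q) (frame y1 y2 u yp yq) =
  frame (- a * y1 + g (vsval v) (J (vsval u)) + c1 * yp)
        (- a * y2 + g (vsval v) (vsval u) + c2 * yp)
        (A u + yp *: v) (a * yp) 0.
Proof.
have adE x : br (e q) x = ad br (e q) x by rewrite /ad lfunE.
rewrite {1}/frame !linearDr !linearZr_LR /= (lie_alternating lie_br) scaler0 addr0.
rewrite !adE (block_e1 block_D) (block_e2 block_D) (block_V block_D).
rewrite (block_last block_D) /restr_form J_V g_J_V opprK.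
rewrite e1_frame e2_frame ep_frame !V_frame !(frameZ, frameD).
congr frame; rewrite ?scaler0 ?addr0 ?add0r //; ring.
Qed.

Lemma h_frame x1 x2 w xp : frame x1 x2 w xp 0 \in h.
Proof.
rewrite (adapted_h adapted) /frame scale0r addr0.
have e_in i : (1 <= i <= p)%N -> e i \in span_range e 1 p.
  by move=> ip; rewrite memv_span // map_f // mem_index_iota; lia.
rewrite !rpredD ?rpredZ ?e_in //; try lia.
move: (subvsP w); apply: subvP; rewrite {1}(adapted_V adapted).
apply: sub_span => x /mapP[i]; rewrite mem_index_iota => ip ->.
by rewrite map_f // mem_index_iota; lia.
Qed.

(** As h is abelian, only the components along e_q contribute to the bracket. *)
Lemma br_frame x1 x2 w xp xq y1 y2 u yp yq :
  br (frame x1 x2 w xp xq) (frame y1 y2 u yp yq) =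
  xq *: br (e q) (frame y1 y2 u yp yq) - yq *: br (e q) (frame x1 x2 w xp xq).
Proof.
have frame_split z1 z2 t zp zq :
    frame z1 z2 t zp zq = frame z1 z2 t zp 0 + zq *: e q.
  by rewrite /frame scale0r addr0.
have brN x y : br x y = - br y x.
  apply/eqP; rewrite -addr_eq0; apply/eqP.
  have := lie_alternating lie_br (x + y).
  by rewrite linearDl !linearDr !(lie_alternating lie_br) add0r addr0.
rewrite (frame_split x1) (frame_split y1).
move: (h_frame x1 x2 w xp) (h_frame y1 y2 u yp).
move: (frame x1 x2 w xp 0) (frame y1 y2 u yp 0) => x y xh yh.
rewrite !linearDl !linearDr !linearZl_LR !linearZr_LR /=.
rewrite (codim1_abelian codim1_h) // (lie_alternating lie_br) !scaler0 !addr0 add0r.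
by rewrite (brN x (e q)) scalerN addrC.
Qed.

(** * The Levi-Civita connection *)

Lemma g_inj (s t : L) : (forall z, g s z = g t z) -> s = t.
Proof.
move=> st; apply/eqP; rewrite -subr_eq0 -memv0 -(eqP (pk_nondegenerate pk)).
by apply/mem_orthovP => z _; rewrite linearBl /= st subrr.
Qed.

(** Pairing with an arbitrary third vector, also in coordinates, reduces the
    Koszul formula to an identity of polynomials.  The coefficient c2 enters the
    e_2 component of D e_p but not that of nabla_(e_q) e_p: it goes entirely to
    nabla_(e_p), since it contributes g(D e_p, e_p) = - c2. *)
Lemma nabla_frame x1 x2 w xp xq y1 y2 u yp yq :
  nabla (frame x1 x2 w xp xq) (frame y1 y2 u yp yq) =
  xp *: frame (- c2 * yp) (- c2 * yq) 0 0 0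
  + xq *: frame (- a * y1 + g (vsval v) (J (vsval u)) + c1 * yp)
        (- a * y2 + g (vsval v) (vsval u) + c1 * yq)
        (A u + yp *: v + yq *: restr_endo V J v) (a * yp) (a * yq).
Proof.
apply: g_inj => z; apply: (@mulfI _ 2); first by rewrite pnatr_eq0.
have [t ->] := frameP z; rewrite lc !br_frame !br_q_frame.
rewrite !(frameZ, frameD) -![- frame _ _ _ _ _]scaleN1r !(frameZ, frameD) !g_frame.
rewrite !(linearDl, linearDr, linearNl, linearNr, linearZl_LR, linearZr_LR,
         linear0l, linearD, linearZ, linearN, linear0) /=.
(* Exchanging the arguments in three of the six products g(A _, _) makes the
   other three cancel against them or add up. *)
rewrite J_V g_J_V (g_A_V t w) (g_A_V u w) (g_A_V t u); ring.
Qed.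

Lemma nabla_q_frame y1 y2 u yp yq :
  nabla (e q) (frame y1 y2 u yp yq) =
  frame (- a * y1 + g (vsval v) (J (vsval u)) + c1 * yp)
        (- a * y2 + g (vsval v) (vsval u) + c1 * yq)
        (A u + yp *: v + yq *: restr_endo V J v) (a * yp) (a * yq).
Proof. by rewrite eq_frame nabla_frame scale0r add0r scale1r. Qed.

Lemma nabla_q_V (x : subvs_of V) : nabla (e q) (vsval x) =
  g (vsval v) (J (vsval x)) *: e 1%N + g (vsval v) (vsval x) *: e 2%N
  + vsval (A x).
Proof.
by rewrite V_frame nabla_q_frame /frame !(mulr0, addr0, add0r, scale0r).
Qed.

Lemma nabla_q_e1 : nabla (e q) (e 1%N) = - a *: e 1%N.
Proof.
rewrite e1_frame nabla_q_frame frameZ.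
by congr frame; rewrite ?(linear0, linear0r, scale0r, scaler0, mulr0, addr0).
Qed.

Lemma nabla_q_e2 : nabla (e q) (e 2%N) = - a *: e 2%N.
Proof.
rewrite e2_frame nabla_q_frame frameZ.
by congr frame; rewrite ?(linear0, linear0r, scale0r, scaler0, mulr0, addr0).
Qed.

Lemma nabla_q_ep :
  nabla (e q) (e p) = c1 *: e 1%N + vsval v + a *: e p.
Proof.
rewrite ep_frame nabla_q_frame /frame !(linear0, linear0r) /=.
by rewrite !(mulr0, mulr1, addr0, add0r, scale0r, scale1r).
Qed.

Lemma nabla_q_eq :
  nabla (e q) (e q) = c1 *: e 2%N + J (vsval v) + a *: e q.
Proof.
rewrite [X in nabla _ X]eq_frame nabla_q_frame /frame !(linear0, linear0r) /=.
by rewrite !(mulr0, mulr1, addr0, add0r, scale0r, scale1r) J_V.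
Qed.

(** * Curvature *)

Local Notation N := (nabla (e p)).
Local Notation M := (nabla (e q)).
Local Notation T := (tensor_endo n e p 1 + tensor_endo n e q 2).

(** The connection factors through the two coordinates transverse to
    Span {e_1, e_2} + V, so that a curvature operator can involve no other
    commutator than [N, M]. *)
Lemma nablaE x : nabla x = d p x *: N + d q x *: M.
Proof.
apply/lfunP => y; rewrite add_lfunE !scale_lfunE.
have [w {1}->] := frameP x; have [u ->] := frameP y.
by rewrite ep_frame eq_frame !nabla_frame !scale0r !scale1r addr0 add0r.
Qed.

Lemma nabla_p_frame x : N x = frame (- c2 * d p x) (- c2 * d q x) 0 0 0.
Proof.
have [u {1}->] := frameP x.
by rewrite ep_frame nabla_frame scale1r scale0r addr0.
Qed.

Lemma nabla_pE : N = - c2 *: T.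
Proof.
apply/lfunP => y; rewrite scale_lfunE add_lfunE !tensor_endoE nabla_p_frame.
by rewrite /frame !scale0r raddf0 !addr0 scalerDr !scalerA.
Qed.

Lemma dual_basis_tensors z k : (k = p \/ k = q) -> d k (T z) = 0.
Proof.
move=> kpq; rewrite add_lfunE !tensor_endoE linearD !linearZ /=.
have [k1 k2 kn] : [/\ (k == 1)%N = false, (k == 2)%N = false & (1 <= k <= q)%N].
  by case: kpq => ->; split; lia.
by rewrite !dual_basisE // ?k1 ?k2 ?mulr0 ?addr0 //; lia.
Qed.

Lemma dual_basis_nabla_q z k : (k = p \/ k = q) -> d k (M z) = a * d k z.
Proof.
have [u {1}->] := frameP z; rewrite nabla_q_frame.
set D1 := (X in frame X); set D2 := (X in frame _ X).
set w := (X in frame _ _ X).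
have [_ _ dp dq] := dual_basis_frame D1 D2 w (a * d p z) (a * d q z).
by case=> ->.
Qed.

(** N reads only the coordinates along e_p and e_q, which M multiplies by a. *)
Lemma nabla_pq z : N (M z) = a *: N z.
Proof.
rewrite nabla_pE !scale_lfunE !add_lfunE !tensor_endoE.
rewrite !dual_basis_nabla_q; [|by right|by left].
by rewrite -!scalerA -scalerDr !scalerA mulrC.
Qed.

(** N takes its values in Span {e_1, e_2}, where M is - a. *)
Lemma nabla_qp z : M (N z) = - a *: N z.
Proof.
rewrite nabla_p_frame nabla_q_frame frameZ.
by congr frame; rewrite ?linear0 ?linear0r ?mulr0 ?scaler0 ?scale0r ?mulr0 ?addr0.
Qed.

Lemma nabla_pp z : N (N z) = 0.
Proof.
rewrite nabla_pE !scale_lfunE add_lfunE !tensor_endoE !linearZ /=.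
rewrite !dual_basis_tensors; [|by right|by left].
by rewrite !mulr0 !scale0r addr0 scaler0.
Qed.

Lemma scaled_nabla_pE : - (3 * a * c2) *: T = (3 * a) *: N.
Proof. by rewrite nabla_pE scalerA mulrN. Qed.

Lemma nabla_h0_orth x1 x2 w : nabla (frame x1 x2 w 0 0) = 0.
Proof.
by rewrite nablaE; have [_ _ -> ->] := dual_basis_frame x1 x2 w 0 0;
  rewrite !scale0r addr0.
Qed.

(** The commutator [N, M] contributes 2 a N, and nabla_[x, y] the third a N,
    through the diagonal entry a of D at e_p. *)
Lemma curvatureE x y : curvature br nabla x y =
  (d p x * d q y - d q x * d p y) *: (- (3 * a * c2) *: T).
Proof.
rewrite scaled_nabla_pE.
have brE : nabla (br x y) = (a * (d q x * d p y - d q y * d p x)) *: N.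
  have [w {1}->] := frameP x; have [u {1}->] := frameP y.
  rewrite br_frame !br_q_frame -scaleN1r !(frameZ, frameD) nablaE.
  set D1 := (X in frame X); set D2 := (X in frame _ X).
  set s := (X in frame _ _ X).
  set fp := (X in frame _ _ _ X); set fq := (X in frame _ _ _ _ X).
  have [_ _ -> ->] := dual_basis_frame D1 D2 s fp fq; rewrite /fp /fq.
  rewrite !mulr0 addr0 scale0r addr0; congr (_ *: _); ring.
rewrite /curvature brE (nablaE x) (nablaE y).
(* The identity of vectors is tested against t to become one of scalars. *)
apply/lfunP => z; apply: g_inj => t.
rewrite !(add_lfunE, opp_lfunE, comp_lfunE, scale_lfunE) !linearD !linearZ /=.
rewrite nabla_pp nabla_pq nabla_qp.
rewrite !(linearDl, linearNl, linearZl_LR, linear0l) /=; ring.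
Qed.

Lemma curvature_basis i j : (1 <= i)%N -> (i < j)%N -> (j <= q)%N ->
  (i, j) <> (p, q) -> curvature br nabla (e i) (e j) = 0.
Proof.
move=> i1 ij jq ijpq; rewrite curvatureE !dual_basisE //; try lia.
have -> : (q == i) = false by lia.
rewrite mul0r subr0 -natrM mulnb.
case: andP => [[/eqP pi /eqP qj]|_]; last by rewrite scale0r.
by case: ijpq; rewrite pi qj.
Qed.

Lemma curvature_pq : curvature br nabla (e p) (e q) = - (3 * a * c2) *: T.
Proof.
have pq : (p == q) = false by lia.
rewrite curvatureE !dual_basisE //; try lia.
by rewrite !eqxx eq_sym pq mulr1 mulr0 subr0 scale1r.
Qed.

(** A rank-one map x |-> phi(x) u has trace phi(u), and here u is in
    Span {e_1, e_2}, which phi kills. *)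
Lemma ricci_flat x y : ricci br nabla x y = 0.
Proof.
pose phi z := d p z * d q x - d q z * d p x.
have lin_phi : scalar phi by move=> c s t; rewrite /phi !linearP /=; ring.
pose Phi : {scalar L} :=
  HB.pack phi (GRing.isLinear.Build R L R *%R phi lin_phi).
rewrite /ricci (endo_trace_rank_one (phi := Phi) (u := (- (3 * a * c2) *: T) y)).
  rewrite scale_lfunE linearZ /= /phi.
  rewrite !dual_basis_tensors; [|by right|by left].
  by rewrite !mul0r subrr mulr0.
by move=> z; rewrite ricciE curvatureE scale_lfunE.
Qed.

End AlmostAbelian.

Unset Implicit Arguments.

Theorem proposition2p3 (R : realType) (n : nat) (L : vectType R)
    (br : {bilinear L -> L -> L}) (J : 'End(L)) (g : {symmetric L})
    (h V : {vspace L}) (e : nat -> L) (eps : nat -> R)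
    (a c1 c2 : R) (v : subvs_of V) (A : 'End(subvs_of V))
    (nabla : {linear L -> 'End(L)}) :
  lie_bracket br ->
  \dim {:L} = (2 * n)%N ->
  codim1_abelian_ideal br h ->
  pseudo_kahler br J g ->
  isotropic g (h0_space J g h) ->
  adapted_basis n e J g h V eps ->
  unitary_algebra (restr_endo V J) (restr_form g) A ->
  block_form n e J g (ad br (e (2 * n)%N)) a c1 c2 v A ->
  levi_civita br g nabla ->
  [/\ nabla (e 1%N) = 0 /\ nabla (e 2%N) = 0,
      {in V, forall x, nabla x = 0},
      nabla (e (2 * n - 1)%N) =
        - c2 *: (tensor_endo n e (2 * n - 1) 1 + tensor_endo n e (2 * n) 2)
    & [/\ forall x : subvs_of V, nabla (e (2 * n)%N) (vsval x) =
            g (vsval v) (J (vsval x)) *: e 1%N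
            + g (vsval v) (vsval x) *: e 2%N + vsval (A x),
          nabla (e (2 * n)%N) (e 1%N) = - a *: e 1%N,
          nabla (e (2 * n)%N) (e 2%N) = - a *: e 2%N,
          nabla (e (2 * n)%N) (e (2 * n - 1)%N) =
            c1 *: e 1%N + vsval v + a *: e (2 * n - 1)%N
        & nabla (e (2 * n)%N) (e (2 * n)%N) =
            c1 *: e 2%N + J (vsval v) + a *: e (2 * n)%N]]
  /\ [/\ forall i j : nat, (1 <= i)%N -> (i < j)%N -> (j <= 2 * n)%N ->
           (i, j) <> ((2 * n - 1)%N, (2 * n)%N) ->
           curvature br nabla (e i) (e j) = 0,
         curvature br nabla (e (2 * n - 1)%N) (e (2 * n)%N) =
           - (3 * a * c2) *:
             (tensor_endo n e (2 * n - 1) 1 + tensor_endo n e (2 * n) 2),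
         - (3 * a * c2) *:
             (tensor_endo n e (2 * n - 1) 1 + tensor_endo n e (2 * n) 2) =
           (3 * a) *: nabla (e (2 * n - 1)%N)
       & forall x y : L, ricci br nabla x y = 0].
Proof.
move=> lie_br dimL codim1_h pk _ adapted unitary_A block_D lc.
have n_ge2 : (2 <= n)%N.
  exact: adapted_basis_ge2 dimL codim1_h (pk_nondegenerate pk) adapted.
have nabla_h := nabla_h0_orth n_ge2 lie_br codim1_h pk adapted unitary_A block_D lc.
split; split.
- by rewrite (e1_frame n V) (e2_frame n V) !nabla_h.
- by move=> x xV; rewrite -(vsprojK xV) (V_frame n e) nabla_h.
- exact: nabla_pE pk adapted unitary_A block_D lc.
- split.
  + exact: nabla_q_V pk adapted unitary_A block_D lc.
  + exact: nabla_q_e1 pk adapted unitary_A block_D lc.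
  + exact: nabla_q_e2 pk adapted unitary_A block_D lc.
  + exact: nabla_q_ep pk adapted unitary_A block_D lc.
  + exact: nabla_q_eq pk adapted unitary_A block_D lc.
- exact: curvature_basis pk adapted unitary_A block_D lc.
- exact: curvature_pq pk adapted unitary_A block_D lc.
- exact: scaled_nabla_pE pk adapted unitary_A block_D lc.
- exact: ricci_flat pk adapted unitary_A block_D lc.
Qed.
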